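(* For all $m,n\ge 1$, $|W_n^{-1}(P_m;123)| = |W_n^{-1}(K_{1,m};132)|$.
   Context: For $\pi=\pi_1\cdots\pi_n\in\mathcal{S}_n$, the digraph $D(\pi)$ has vertices $1,\dots,n$ and an arc from $j$ to $i$ whenever $i<j$ and $\pi_i<\pi_j$. The weighted competition graph $W(\pi)$ is the edge-weighted simple graph on the same vertices in which distinct $u,v$ are joined by an edge iff they have a common out-neighbor in $D(\pi)$, with weight equal to the number of common out-neighbors. $P_m$ is the path with $m+1$ vertices and $m$ edges and $K_{1,m}$ is the star with one center and $m$ leaves, all edge weights equal to $1$. For an edge-weighted graph $G$ and a pattern $\tau$, $W_n^{-1}(G;\tau)$ is the set of $\pi\in\mathcal{S}_n$ avoiding $\tau$ (having no subsequence order-isomorphic to $\tau$) such that $W(\pi)$ is isomorphic, as an edge-weighted graph, to $G$ together with some number of isolated vertices. *)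

(* Defs.v *)
From mathcomp Require Import all_boot all_fingroup.
From mathcomp Require Import boolp.

Set Implicit Arguments.
Unset Strict Implicit.
Unset Printing Implicit Defensive.

(* Only the values of [wt] on adjacent pairs are meaningful. *)
Record wgraph := WGraph {
  vert : finType;
  adj : rel vert;
  wt : vert -> vert -> nat;
  adj_sym : symmetric adj;
  adj_irr : irreflexive adj;
  wt_sym : forall u v, adj u v -> wt u v = wt v u
}.

Definition wg_iso (G H : wgraph) : Prop :=
  exists f : vert G -> vert H,
    [/\ bijective f,
        forall u v, adj (f u) (f v) = adj u v
      & forall u v, adj u v -> wt (f u) (f v) = wt u v].

Section AddIsolated.
Variables (G : wgraph) (k : nat).

Definition isol_adj (u v : vert G + 'I_k) : bool :=
  match u, v with inl x, inl y => adj x y | _, _ => false end.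

Definition isol_wt (u v : vert G + 'I_k) : nat :=
  match u, v with inl x, inl y => wt x y | _, _ => 0 end.

Fact isol_adj_sym : symmetric isol_adj.
Proof. by move=> [x|x] [y|y] //=; apply: adj_sym. Qed.

Fact isol_adj_irr : irreflexive isol_adj.
Proof. by move=> [x|x] //=; apply: adj_irr. Qed.

Fact isol_wt_sym u v : isol_adj u v -> isol_wt u v = isol_wt v u.
Proof. by case: u v => [x|x] [y|y] //=; apply: wt_sym. Qed.

Definition add_isolated : wgraph :=
  @WGraph (vert G + 'I_k)%type isol_adj isol_wt
    isol_adj_sym isol_adj_irr isol_wt_sym.

End AddIsolated.

Section UnitWeight.
Variables (V : finType) (e : rel V).
Hypotheses (e_sym : symmetric e) (e_irr : irreflexive e).

Definition unit_wgraph : wgraph :=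
  @WGraph V e (fun _ _ => 1) e_sym e_irr (fun _ _ _ => erefl).

End UnitWeight.

Section PathStar.
Variable m : nat.

Definition path_adj (i j : 'I_m.+1) : bool :=
  (i.+1 == j :> nat) || (j.+1 == i :> nat).

Fact path_adj_sym : symmetric path_adj.
Proof. by move=> i j; rewrite /path_adj orbC. Qed.

Fact path_adj_irr : irreflexive path_adj.
Proof. by move=> i; rewrite /path_adj orbb -[X in _ == X]addn0 -addn1 eqn_add2l. Qed.

Definition path_graph : wgraph := unit_wgraph path_adj_sym path_adj_irr.

Definition star_adj (i j : 'I_m.+1) : bool :=
  (i != j) && ((i == ord0) || (j == ord0)).

Fact star_adj_sym : symmetric star_adj.
Proof. by move=> i j; rewrite /star_adj eq_sym orbC. Qed.

Fact star_adj_irr : irreflexive star_adj.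
Proof. by move=> i; rewrite /star_adj eqxx. Qed.

Definition star_graph : wgraph := unit_wgraph star_adj_sym star_adj_irr.

End PathStar.

Section Competition.
Variables (n : nat) (s : 'S_n).

Definition darc (j i : 'I_n) : bool := (i < j) && (s i < s j).

Definition common_out (u v : 'I_n) : {set 'I_n} :=
  [set x | darc u x && darc v x].

Definition comp_adj (u v : 'I_n) : bool :=
  (u != v) && (common_out u v != set0).

Definition comp_wt (u v : 'I_n) : nat := #|common_out u v|.

Fact common_outC u v : common_out u v = common_out v u.
Proof. by apply/setP=> x; rewrite !inE andbC. Qed.

Fact comp_adj_sym : symmetric comp_adj.
Proof. by move=> u v; rewrite /comp_adj eq_sym common_outC. Qed.

Fact comp_adj_irr : irreflexive comp_adj.
Proof. by move=> u; rewrite /comp_adj eqxx. Qed.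

Fact comp_wt_sym u v : comp_adj u v -> comp_wt u v = comp_wt v u.
Proof. by move=> _; rewrite /comp_wt common_outC. Qed.

Definition competition_graph : wgraph :=
  @WGraph 'I_n comp_adj comp_wt comp_adj_sym comp_adj_irr comp_wt_sym.

End Competition.

(* [f] lists the positions of a subsequence of [s] order-isomorphic to [t]. *)
Definition contains n k (s : 'S_n) (t : 'S_k) : Prop :=
  exists f : 'I_k -> 'I_n,
    (forall a b : 'I_k, a < b -> f a < f b) /\
    (forall a b : 'I_k, (s (f a) < s (f b)) = (t a < t b)).

Definition avoids n k (s : 'S_n) (t : 'S_k) : Prop := ~ contains s t.

(* Positions and values are numbered from 0, so 123 is 0 |-> 0, 1 |-> 1,
   2 |-> 2 and 132 is 0 |-> 0, 1 |-> 2, 2 |-> 1. *)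
Definition pat123 : 'S_3 := 1%g.
Definition pat132 : 'S_3 := tperm (inord 1) (inord 2).

Definition Winv n (G : wgraph) k (t : 'S_k) : {set 'S_n} :=
  [set s : 'S_n |
     `[< avoids s t /\
         exists r, wg_iso (competition_graph s) (add_isolated G r) >]].

(* Main.v *)
Require Import Defs.
From mathcomp Require Import all_boot all_order all_fingroup.
From mathcomp Require Import boolp zify.

Set Implicit Arguments.
Unset Strict Implicit.
Unset Printing Implicit Defensive.

(** Both families are recognised on the Lehmer code [c_p = #{i < p | s_i < s_p}],
    a bijection from [S_n] to the inversion sequences.

    If [s] avoids 123, the out-neighbours of a non-minimum are consecutive
    left-to-right minima, and two non-minima [u < v] have
    [c_v - #{minima between u and v}] of them in common (truncated subtraction).
    Unit weights and the absence of triangles leave only edges between consecutive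
    non-minima: [v] is joined to the previous one iff it is a contact, that is,
    [c_v = z + 1] where [z] is the number of minima between them. The graph is a
    path with [m] edges iff there are [m] contacts, they are consecutive among the
    non-minima, and none but the last has [z = 0].

    If [s] avoids 132, the code of its reverse-complement is the sequence of
    depths, in preorder, of a plane forest, and a vertex with [d] proper descendants
    is joined with weight [d] to each of its proper ancestors. Unit weights mean that
    no letter exceeds 2 and that every letter 2 follows a letter 1; each 2 then makes
    an edge from its parent to the root of its tree. The graph is a star with [m]
    edges iff there are [m] letters 2, all of them in the same tree.

    Both graphs join each vertex to at most one smaller vertex, just as [P_m] and
    [K_{1,m}] do, so that a common theory of such forests gives the isomorphisms.
    Both conditions on codes are tested by automata reading the letters from left to
    right, and the numbers of accepted codes satisfy matching recurrences. *)

(** * Counting on initial segments *)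

Section CountIota.
Variable a : pred nat.

Lemma count_iota n : count a (iota 0 n) = \sum_(i < n) a i.
Proof.
rewrite -(big_mkord xpredT (fun i => a i : nat)) /index_iota subn0.
by rewrite -sum1_count big_mkcond; apply: eq_bigr => i _; case: (a i).
Qed.

Lemma card_ord_count n : #|[set x : 'I_n | a x]| = count a (iota 0 n).
Proof. by rewrite -sum1dep_card count_iota big_mkcond; apply: eq_bigr => i _; case: (a i). Qed.

Lemma count_iotaS n : count a (iota 0 n.+1) = count a (iota 0 n) + a n.
Proof. by rewrite -addn1 iotaD count_cat /= addn0. Qed.

Lemma leq_count_iota p q : p <= q -> count a (iota 0 p) <= count a (iota 0 q).
Proof. by move=> /subnKC <-; rewrite iotaD count_cat leq_addr. Qed.

Lemma count_iota_ltn k n : k <= n ->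
  count (fun x => (x < k) && a x) (iota 0 n) = count a (iota 0 k).
Proof.
move=> kn; rewrite -(subnKC kn) iotaD count_cat -[RHS]addn0; congr (_ + _).
  by apply: eq_in_count => x; rewrite mem_iota => /andP[_ ->].
apply/eqP; rewrite -leqn0 leqNgt -has_count; apply/hasPn => x; rewrite mem_iota => /andP[kx _].
by rewrite ltnNge kx.
Qed.

Lemma nth_filter_iota n v : v < n -> a v ->
  nth 0 [seq x <- iota 0 n | a x] (count a (iota 0 v)) = v.
Proof.
move=> vn av; rewrite -(subnKC vn) -addn1 -addnA iotaD filter_cat nth_cat size_filter ltnn subnn.
by rewrite iotaD filter_cat /= av.
Qed.

Lemma nth_filter_iotaP n j (v := nth 0 [seq x <- iota 0 n | a x] j) :
  j < count a (iota 0 n) -> [/\ v < n, a v & count a (iota 0 v) = j].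
Proof.
rewrite -size_filter => js; have : v \in [seq x <- iota 0 n | a x] by rewrite mem_nth.
rewrite mem_filter mem_iota => /andP[av vn]; split=> //; apply/eqP.
rewrite -(@nth_uniq _ 0 [seq x <- iota 0 n | a x]) ?filter_uniq ?iota_uniq //.
  by rewrite nth_filter_iota.
by rewrite size_filter; have := leq_count_iota vn; rewrite count_iotaS av addn1.
Qed.

End CountIota.

Lemma uniq_leq_count (T : eqType) (a : pred T) (s L : seq T) :
  uniq L -> all (fun x => (x \in s) && a x) L -> size L <= count a s.
Proof.
move=> uL /allP aL; rewrite -size_filter; apply: uniq_leq_size => // x /aL.
by rewrite mem_filter andbC.
Qed.

(** * Lehmer codes *)

Section LehmerCode.
Variable g : nat -> nat.

Definition below p := [seq x <- iota 0 p | g x < g p].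

Definition lehmer p := size (below p).

Lemma mem_below p x : (x \in below p) = (x < p) && (g x < g p).
Proof. by rewrite mem_filter mem_iota andbC. Qed.

Lemma below_sorted p : sorted ltn (below p).
Proof. by apply: sorted_filter (iota_ltn_sorted 0 p); exact: ltn_trans. Qed.

Lemma nth_below p i : i < lehmer p ->
  nth 0 (below p) i < p /\ g (nth 0 (below p) i) < g p.
Proof. by move=> ip; apply/andP; rewrite -mem_below mem_nth. Qed.

Lemma ltn_nth_below p i j : i < j -> j < lehmer p -> nth 0 (below p) i < nth 0 (below p) j.
Proof.
move=> ij jp; apply: (sorted_ltn_nth ltn_trans) => //; first exact: below_sorted.
exact: ltn_trans jp.
Qed.

Lemma lehmerE p : lehmer p = count (fun x => g x < g p) (iota 0 p).
Proof. exact: size_filter. Qed.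

Lemma lehmer_le p : lehmer p <= p.
Proof. by rewrite lehmerE -[leqRHS](size_iota 0 p) count_size. Qed.

Lemma leq_lehmer (L : seq nat) p :
  uniq L -> all (fun x => (x < p) && (g x < g p)) L -> size L <= lehmer p.
Proof. by move=> uL /allP bL; apply: uniq_leq_size => // x /bL; rewrite mem_below. Qed.

Lemma lehmer_gt0P p : reflect (exists2 x, x < p & g x < g p) (0 < lehmer p).
Proof.
rewrite lehmerE -has_count; apply: (iffP hasP) => -[x xp gx]; exists x => //.
  by move: xp; rewrite mem_iota.
by rewrite mem_iota.
Qed.

Lemma lehmer_ltn p q : p < q -> g p < g q -> lehmer p < lehmer q.
Proof.
move=> pq gpq; apply: (@leq_lehmer (p :: below p)) => /=.
  by rewrite mem_below ltnn filter_uniq ?iota_uniq.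
by rewrite pq gpq; apply/allP => x; rewrite mem_below; lia.
Qed.

Lemma lehmerS_leq p : g p.+1 <= g p -> lehmer p.+1 <= lehmer p.
Proof.
move=> gp; apply: uniq_leq_size; first by rewrite filter_uniq ?iota_uniq.
move=> x; rewrite !mem_below ltnS leq_eqVlt => /andP[/predU1P[->|xp]]; first by lia.
by rewrite xp; lia.
Qed.

Lemma ltn_lehmer_rank p i : i < p ->
  (g i < g p) = (count (fun x => g x < g i) (iota 0 p) < lehmer p).
Proof.
rewrite lehmerE => ip; case: ltnP => [lt_ip|le_pi]; apply/esym.
  have -> : count (fun x => g x < g p) (iota 0 p) =
      count (fun x => g x < g i) (iota 0 p) + count (fun x => g i <= g x < g p) (iota 0 p).
    rewrite -count_predUI [X in _ + X](@eq_count _ _ pred0) ?count_pred0 ?addn0.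
      by apply: eq_count => x /=; lia.
    by move=> x /=; lia.
  rewrite -[ltnLHS]addn0 ltn_add2l -has_count; apply/hasP; exists i; last by lia.
  by rewrite mem_iota.
by apply/negbTE; rewrite -leqNgt; apply: sub_count => x /=; lia.
Qed.

Hypothesis g_inj : injective g.

Lemma ltn_of_lehmer0 p x : lehmer p = 0 -> x < p -> g p < g x.
Proof.
move=> c0 xp; rewrite ltn_neqAle; apply/andP; split.
  by apply/eqP => /g_inj; lia.
by rewrite leqNgt; apply/negP => gx; have /lehmer_gt0P : exists2 x, x < p & g x < g p;
  [exists x | rewrite c0].
Qed.

End LehmerCode.

Definition perm_fun n (s : 'S_n) (i : nat) : nat :=
  if insub i is Some o then s o else i.

Lemma perm_funE n (s : 'S_n) (i : 'I_n) : perm_fun s i = s i.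
Proof. by rewrite /perm_fun valK. Qed.

Lemma perm_fun_inj n (s : 'S_n) : injective (perm_fun s).
Proof.
move=> i j; rewrite /perm_fun.
case: (@insubP _ _ ('I_n) i) => [a _ <-|ni]; case: (@insubP _ _ ('I_n) j) => [b _ <-|nj] //.
- by move=> /val_inj /perm_inj ->.
- by move=> e; rewrite -e ltn_ord in nj.
- by move=> e; rewrite e ltn_ord in ni.
Qed.

Definition code n (s : 'S_n) : seq nat := mkseq (lehmer (perm_fun s)) n.

Lemma lehmer_order (f g : nat -> nat) n : injective f -> injective g ->
    (forall p, p < n -> lehmer f p = lehmer g p) ->
  forall i j, i < n -> j < n -> (f i < f j) = (g i < g j).
Proof.
move=> f_inj g_inj; elim: n => // n IH eq_fg.
have {}IH : forall i j, i < n -> j < n -> (f i < f j) = (g i < g j).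
  by apply: IH => p pn; apply: eq_fg; lia.
have last_order i : i < n -> (f i < f n) = (g i < g n).
  move=> lt_in; rewrite !ltn_lehmer_rank ?eq_fg //; congr (_ < _).
  by apply: eq_in_count => x; rewrite mem_iota => /andP[_ xn]; exact: IH.
have last_order' i : i < n -> (f n < f i) = (g n < g i).
  move=> lt_in; have := last_order i lt_in.
  have : f n != f i by rewrite (inj_eq f_inj); lia.
  by have : g n != g i; [rewrite (inj_eq g_inj); lia | lia].
move=> i j; rewrite !ltnS [i <= n]leq_eqVlt [j <= n]leq_eqVlt.
move=> /predU1P[->|lt_in] /predU1P[->|lt_jn]; rewrite ?ltnn //.
- exact: last_order'.
- exact: last_order.
- exact: IH.
Qed.

Lemma perm_order_inj n (s t : 'S_n) :
  (forall i j, (s i < s j) = (t i < t j)) -> s = t.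
Proof.
move=> st; suff st_id : (s^-1 * t)%g =1 id.
  by apply/permP => i; have := st_id (s i); rewrite permM permK.
apply: Order.mono_unique => //; first exact: Order.le_total.
by move=> i j; rewrite !leEord !permM /= leqNgt -st !permKV -leqNgt.
Qed.

Lemma code_inj n : injective (@code n).
Proof.
move=> s t eq_st; apply: perm_order_inj => i j.
rewrite -!(perm_funE s) -!(perm_funE t); apply: lehmer_order => // [||p pn].
- exact: perm_fun_inj.
- exact: perm_fun_inj.
- by have := congr1 (fun w => nth 0 w p) eq_st; rewrite /= !nth_mkseq.
Qed.

Fixpoint inversion_seqs n : seq (seq nat) :=
  if n is n'.+1 then [seq rcons w c | w <- inversion_seqs n', c <- iota 0 n]
  else [:: [::]].

Lemma size_inversion_seqs n : size (inversion_seqs n) = n`!.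
Proof. by elim: n => // n IH; rewrite size_allpairs IH size_iota factS mulnC. Qed.

Lemma inversion_seqs_rconsP n w :
  reflect (exists u c, [/\ u \in inversion_seqs n, c <= n & w = rcons u c])
    (w \in inversion_seqs n.+1).
Proof.
apply: (iffP allpairsP) => [[[u c] [un]]|[u [c [un cn ->]]]].
  by rewrite mem_iota => cn ->; exists u, c.
by exists (u, c); rewrite mem_iota.
Qed.

Lemma mem_inversion_seqs g n : mkseq (lehmer g) n \in inversion_seqs n.
Proof.
elim: n => // n IH; apply/inversion_seqs_rconsP.
by exists (mkseq (lehmer g) n), (lehmer g n); rewrite mkseqS lehmer_le.
Qed.

Lemma perm_code n : perm_eq [seq code s | s <- enum {: 'S_n}] (inversion_seqs n).
Proof.
have uniq_codes : uniq [seq code s | s <- enum {: 'S_n}].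
  by rewrite map_inj_uniq ?enum_uniq //; exact: code_inj.
have sub_codes : {subset [seq code s | s <- enum {: 'S_n}] <= inversion_seqs n}.
  by move=> w /mapP[s _ ->]; exact: mem_inversion_seqs.
have le_size : size (inversion_seqs n) <= size [seq code s | s <- enum {: 'S_n}].
  by rewrite size_inversion_seqs size_map -cardE card_Sn.
apply: uniq_perm => //; first exact: leq_size_uniq le_size.
by have [] := uniq_min_size uniq_codes sub_codes le_size.
Qed.

Lemma card_code n (P : pred (seq nat)) :
  #|[set s : 'S_n | P (code s)]| = count P (inversion_seqs n).
Proof.
by rewrite -(seq.permP (perm_code n)) -sum1_count big_map big_enum_cond -sum1dep_card.
Qed.

(** * Counting codes with automata *)

Section Automaton.
Variables (S : Type) (legal : S -> nat -> bool) (next : S -> nat -> S) (s0 : S).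

Definition step (st : option S) (c : nat) : option S :=
  if st is Some s then if legal s c then Some (next s c) else None else None.

Definition run : seq nat -> option S := foldl step (Some s0).

Definition accepts (final : pred S) (w : seq nat) := oapp final false (run w).

Definition weight (f : S -> nat) n := \sum_(w <- inversion_seqs n) oapp f 0 (run w).

Definition trace (c : nat -> nat) p := foldl next s0 (mkseq c p).

Lemma run_rcons w c : run (rcons w c) = step (run w) c.
Proof. exact: foldl_rcons. Qed.

Lemma traceS c p : trace c p.+1 = next (trace c p) (c p).
Proof. by rewrite /trace mkseqS foldl_rcons. Qed.

Lemma accepts_mkseqP (final : pred S) c n :
  reflect ((forall p, p < n -> legal (trace c p) (c p)) /\ final (trace c n))
    (accepts final (mkseq c n)).
Proof.
have run_mkseq : run (mkseq c n) =
    if all (fun p => legal (trace c p) (c p)) (iota 0 n) then Some (trace c n) else None.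
  elim: n => // n IH; rewrite mkseqS run_rcons IH -addn1 iotaD all_cat /= andbT.
  by case: all => //=; rewrite add0n addn1 traceS.
rewrite /accepts run_mkseq; case: ifP => [/allP legal_c|/negP illegal] /=.
  apply: (iffP idP) => [fin|[]//]; split=> // p pn.
  by apply: legal_c; rewrite mem_iota.
constructor => -[legal_c _]; case: illegal; apply/allP => p.
by rewrite mem_iota => pn; apply: legal_c.
Qed.

Lemma count_accepts (final : pred S) n :
  count (accepts final) (inversion_seqs n) = weight (fun s => final s) n.
Proof.
rewrite -sum1_count big_mkcond; apply: eq_bigr => w _.
by rewrite /accepts; case: run => //= s; case: (final s).
Qed.

Lemma weight0 f : weight f 0 = f s0.
Proof. by rewrite /weight big_seq1. Qed.

Lemma eq_weight f h n : f =1 h -> weight f n = weight h n.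
Proof. by move=> fh; apply: eq_bigr => w _; case: run => //= s. Qed.

Lemma weightD f h n : weight (fun s => f s + h s) n = weight f n + weight h n.
Proof. by rewrite -big_split; apply: eq_bigr => w _; case: run. Qed.

Variable inv : nat -> S -> Prop.
Hypotheses (inv0 : inv 0 s0)
  (invS : forall n s c, inv n s -> c <= n -> legal s c -> inv n.+1 (next s c)).

Lemma run_inv n w s : w \in inversion_seqs n -> run w = Some s -> inv n s.
Proof.
elim: n w s => [|n IH] w s; first by rewrite inE => /eqP -> [<-].
move=> /inversion_seqs_rconsP[u [c [un cn ->]]]; rewrite run_rcons.
case Eu : (run u) => [t|] //=; case: ifP => // legal_c [<-].
by apply: invS => //; exact: IH Eu.
Qed.

Lemma weightS f h n :
    (forall s, inv n s -> \sum_(0 <= c < n.+1 | legal s c) f (next s c) = h s) ->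
  weight f n.+1 = weight h n.
Proof.
move=> fh; rewrite /weight big_allpairs_dep.
apply: eq_big_seq => w wn; rewrite -/(index_iota 0 n.+1).
under eq_bigr => c _ do rewrite run_rcons.
case Ew : (run w) => [s|] /=; last by rewrite big1.
rewrite -fh; last exact: run_inv Ew.
by rewrite [RHS]big_mkcond; apply: eq_bigr => c _; case: (legal s c).
Qed.

End Automaton.

Section Counting.
Variable m : nat.

(* In a state [(k, z)], the letters read so far have made [k] contacts and end
   with exactly [z] zeros. *)
Definition path_next (s : nat * nat) (c : nat) : nat * nat :=
  (s.1 + (c == s.2.+1), if c == 0 then s.2.+1 else 0).

Definition path_legal (s : nat * nat) (c : nat) : bool :=
  [|| c == 0,
      (c <= s.2) && ((s.1 == 0) || (s.1 == m))
    | [&& c == s.2.+1, s.1 < m & (s.1.+1 == m) || (0 < s.2)]].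

(* In a state [(k, a)], the letters read so far include [k] letters 2 and end
   with [a]. *)
Definition star_next (s : nat * nat) (c : nat) : nat * nat := (s.1 + (c == 2), c).

Definition star_legal (s : nat * nat) (c : nat) : bool :=
  [|| (c == 0) && ((s.1 == 0) || (s.1 == m)),
      c == 1
    | [&& c == 2, s.2 == 1 & s.1 < m]].

Definition path_accepts := accepts path_legal path_next (0, 0) (fun s => s.1 == m).
Definition star_accepts := accepts star_legal star_next (0, 0) (fun s => s.1 == m).

Definition path_weight := weight path_legal path_next (0, 0).
Definition star_weight := weight star_legal star_next (0, 0).

Lemma sum_path_letters (f : nat * nat -> nat) n k z : z <= n ->
  \sum_(0 <= c < n.+1 | path_legal (k, z) c) f (path_next (k, z) c) =
  f (k, z.+1) + ((k == 0) || (k == m)) * z * f (k, 0) +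
  [&& z < n, k < m & (k.+1 == m) || (0 < z)] * f (k.+1, 0).
Proof.
move=> zn; rewrite big_mkcond big_nat_recl // /path_legal /path_next /= addn0 -addnA; congr (_ + _).
rewrite (big_cat_nat (n := z)) //=; congr (_ + _).
  rewrite (eq_big_nat _ _ (F2 := fun _ => ((k == 0) || (k == m)) * f (k, 0))).
    by rewrite sum_nat_const_nat subn0; lia.
  move=> c /andP[_ cz]; rewrite eqSS cz (ltn_eqF cz) orbF addn0.
  by case: ifP; lia.
case: (ltnP z n) => zn'; last by rewrite big_geq ?mul0n.
rewrite big_ltn // big_nat big1 ?addn0 => [|c /andP[zc _]].
  by rewrite ltnn eqxx addn1; case: ifP; lia.
by rewrite ltnNge (ltnW zc) eqSS (gtn_eqF zc).
Qed.

Lemma sum_star_letters (f : nat * nat -> nat) n k a :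
  \sum_(0 <= c < n.+1 | star_legal (k, a) c) f (star_next (k, a) c) =
  ((k == 0) || (k == m)) * f (k, 0) + (0 < n) * f (k, 1) +
  [&& 1 < n, a == 1 & k < m] * f (k.+1, 2).
Proof.
rewrite big_mkcond big_nat_recl //= /star_legal /star_next /= orbF addn0 -addnA.
congr (_ + _); first by case: ifP; lia.
case: n => [|n]; first by rewrite big_geq.
rewrite big_nat_recl //= addn0 mul1n; congr (_ + _).
case: n => [|n]; first by rewrite big_geq.
rewrite big_nat_recl //= addn1 big1 // addn0.
by case: ifP; lia.
Qed.

Lemma path_weightS (f h : nat * nat -> nat) n :
    (forall k z, z <= n -> k <= m -> (0 < k -> z < n) ->
      f (k, z.+1) + ((k == 0) || (k == m)) * z * f (k, 0) +
      [&& z < n, k < m & (k.+1 == m) || (0 < z)] * f (k.+1, 0) = h (k, z)) ->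
  path_weight f n.+1 = path_weight h n.
Proof.
move=> fh; apply: (weightS (inv := fun n s => [/\ s.2 <= n, s.1 <= m & 0 < s.1 -> s.2 < n])) => //.
  move=> p [k z] c [/= zp km kz] cp; rewrite /path_legal /path_next /=.
  by case: ifP => c0 legal_c; split=> /=; lia.
by move=> [k z] [zn km kz]; rewrite sum_path_letters // fh.
Qed.

Lemma star_weightS (f h : nat * nat -> nat) n :
    (forall k a, k <= m -> (n <= 1 -> k = 0 /\ a = 0) ->
      ((k == 0) || (k == m)) * f (k, 0) + (0 < n) * f (k, 1) +
      [&& 1 < n, a == 1 & k < m] * f (k.+1, 2) = h (k, a)) ->
  star_weight f n.+1 = star_weight h n.
Proof.
move=> fh; apply: (weightS (inv := fun n s => s.1 <= m /\ (n <= 1 -> s = (0, 0)))) => //.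
  move=> p [k a] c [/= km ka] cn; rewrite /star_legal /star_next /= => legal_c; split; first by lia.
  by move=> n0; have [] := ka (leqW n0); rewrite (_ : c = 0) => [->|] //; lia.
by move=> [k a] [km ka]; rewrite sum_star_letters fh // => /ka[].
Qed.

(* A code with [k = 0] has read only zeros exactly when [z] is its length. *)
Definition path_started k n (s : nat * nat) := (s.1 == k) && ((0 < k) || (s.2 < n)).

Definition path_count k n := path_weight (path_started k n) n.
Definition path_count_zero k n :=
  path_weight (fun s => path_started k n s && (0 < s.2)) n.
Definition path_zeros k n := path_weight (fun s => (s.1 == k) * s.2) n.
Definition star_count k n := star_weight (fun s => s.1 == k) n.
Definition star_count_one k n := star_weight (fun s => (s.1 == k) && (s.2 == 1)) n.

Hypothesis m_gt0 : 0 < m.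

Lemma all_zero_count n : path_weight (fun s => (s.1 == 0) && (s.2 == n)) n = 1.
Proof.
elim: n => [|n IH]; first by rewrite /path_weight weight0.
by rewrite -[RHS]IH; apply: path_weightS => k z /=; nia.
Qed.

Lemma path_count0S n : path_count 0 n.+1 = path_count 0 n + path_zeros 0 n.
Proof.
apply: (@addIn 1); rewrite -{1}(all_zero_count n.+1) -(all_zero_count n) addnAC.
rewrite /path_count /path_zeros /path_weight -!weightD.
apply: path_weightS => k z; rewrite /path_started /=.
by case: (eqVneq k 0) => [->|] /=; lia.
Qed.

Lemma path_zeros0S n : path_zeros 0 n.+1 = path_count 0 n + 1 + path_zeros 0 n.
Proof.
rewrite -(all_zero_count n) /path_count /path_zeros /path_weight -!weightD.
apply: path_weightS => k z; rewrite /path_started /=.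
by case: (eqVneq k 0) => [->|] /=; lia.
Qed.

Lemma path_count0E n : (path_count 0 n.+1).+1 = 2 ^ n.
Proof.
suff [] : (path_count 0 n.+1).+1 = 2 ^ n /\ path_zeros 0 n.+1 = 2 ^ n by [].
elim: n => [|n [IH1 IH2]].
  have [c0 z0] : path_count 0 0 = 0 /\ path_zeros 0 0 = 0.
    by split; rewrite /path_count /path_zeros /path_weight weight0.
  by rewrite path_count0S path_zeros0S c0 z0.
by rewrite path_count0S (path_zeros0S n.+1) expnS; lia.
Qed.

Lemma path_count_zeroS k n : k < m -> path_count_zero k n.+1 = path_count k n.
Proof. by move=> km; apply: path_weightS => j z; rewrite /path_started /=; lia. Qed.

Lemma path_countS k n : k.+1 < m ->
  path_count k.+1 n.+1 = path_count k.+1 n + path_count_zero k n.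
Proof.
move=> km; rewrite /path_count /path_count_zero /path_weight -!weightD.
apply: path_weightS => j z; rewrite /path_started /=.
case: (eqVneq j k.+1) => [->|jk] /=; last by rewrite muln0; lia.
by rewrite (ltn_eqF km) /= mul0n; lia.
Qed.

Lemma path_count_maxS n :
  path_count m n.+1 = path_count m n + path_zeros m n + path_count m.-1 n.
Proof.
rewrite /path_count /path_zeros /path_weight -!weightD.
by apply: path_weightS => j z; rewrite /path_started /=;
  case: (eqVneq j m) => [->|jm]; rewrite ?orbT /=; case: z; nia.
Qed.

Lemma path_zeros_maxS n : path_zeros m n.+1 = path_zeros m n + path_count m n.
Proof.
rewrite /path_count /path_zeros /path_weight -!weightD.
by apply: path_weightS => j z; rewrite /path_started /=;
  case: (eqVneq j m) => [->|jm]; rewrite ?orbT /=; case: z; nia.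
Qed.

Lemma star_count0E n : star_count 0 n.+1 = 2 ^ n.
Proof.
elim: n => [|n IH].
  rewrite -[RHS](weight0 star_legal star_next (0, 0) (fun s => s.1 == 0)).
  by apply: star_weightS => j a /=; lia.
rewrite expnS mul2n -addnn -!IH /star_count /star_weight -weightD.
by apply: star_weightS => j a /=; lia.
Qed.

Lemma star_count_oneS k n : 0 < k + n -> star_count_one k n.+1 = star_count k n.
Proof. by move=> kn; apply: star_weightS => j a /=; lia. Qed.

Lemma star_countS k n : k.+1 < m ->
  star_count k.+1 n.+1 = star_count k.+1 n + star_count_one k n.
Proof.
move=> km; rewrite /star_count /star_count_one /star_weight -weightD.
by apply: star_weightS => j a /=; lia.
Qed.

Lemma star_count_maxS n :
  star_count m n.+1 = star_count m n + star_count m n + star_count_one m.-1 n.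
Proof.
rewrite /star_count /star_count_one /star_weight -!weightD.
by apply: star_weightS => j a /=; lia.
Qed.

Lemma counts_nil k : [/\ path_count k 0 = 0, path_count_zero k 0 = 0, star_count_one k 0 = 0
  & 0 < k -> star_count k 0 = 0 /\ path_zeros k 0 = 0].
Proof.
rewrite /path_count /path_count_zero /star_count_one /star_count /path_zeros.
by rewrite /path_weight /star_weight !weight0 /path_started /=; split; lia.
Qed.

Lemma path_count0_diff n : path_count 0 n.+1 = path_count 0 n + star_count_one 0 n.+1.
Proof.
case: n => [|n]; last first.
  have := path_count0E n.+1; have := path_count0E n.
  by rewrite star_count_oneS // star_count0E expnS; lia.
have [-> _ _ _] := counts_nil 0; have := path_count0E 0.
have -> : star_count_one 0 1 = star_weight (fun=> 0) 0.
  by apply: star_weightS => j a /=; lia.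
by rewrite /star_weight weight0; lia.
Qed.

Lemma path_count_diff k n : k < m ->
  path_count k n.+1 = path_count k n + star_count_one k n.+1.
Proof.
elim: k n => [|k IH] n km; first exact: path_count0_diff.
have km' : k < m by lia.
rewrite path_countS //; congr (_ + _).
elim: n => [|n IHn].
  have [_ -> _ _] := counts_nil k; have [_ _ _ [//|nil_k1 _]] := counts_nil k.+1.
  by rewrite star_count_oneS.
rewrite star_count_oneS // star_countS // -star_count_oneS // -IHn path_count_zeroS //.
case: n {IHn} => [|n]; last by rewrite path_count_zeroS // -IH.
by have [-> -> -> _] := counts_nil k.
Qed.

Lemma path_star_count n : path_count m n = star_count m n.
Proof.
suff [] : path_count m n = star_count m n /\
    path_zeros m n + path_count m.-1 n = star_count m n + star_count_one m.-1 n by [].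
elim: n => [|n [IH1 IH2]].
  have [-> _ _ [//|-> ->]] := counts_nil m.
  by have [-> _ -> _] := counts_nil m.-1.
have := path_count_maxS n; have := path_zeros_maxS n; have := star_count_maxS n.
by have pm : m.-1 < m; [lia | have := path_count_diff n pm; lia].
Qed.

Lemma count_path_star n :
  count path_accepts (inversion_seqs n) = count star_accepts (inversion_seqs n).
Proof.
rewrite !count_accepts -[RHS]/(star_count m n) -path_star_count.
by apply: eq_weight => s; rewrite /path_started m_gt0 andbT.
Qed.

End Counting.

(** * Weighted graphs *)

Section WeightedGraphs.
Implicit Types G H K : wgraph.

Lemma wg_iso_sym G H : wg_iso G H -> wg_iso H G.
Proof.
move=> [f [[f' fK f'K] f_adj f_wt]]; exists f'; split; first by exists f.
  by move=> u v; rewrite -f_adj !f'K.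
by move=> u v; rewrite -{1}(f'K u) -{1}(f'K v) f_adj => /f_wt; rewrite !f'K.
Qed.

Lemma wg_iso_trans G H K : wg_iso G H -> wg_iso H K -> wg_iso G K.
Proof.
move=> [f [f_bij f_adj f_wt]] [h [h_bij h_adj h_wt]]; exists (h \o f); split.
- exact: bij_comp.
- by move=> u v; rewrite /= h_adj f_adj.
- by move=> u v uv; rewrite /= h_wt ?f_wt // f_adj.
Qed.

Lemma unit_wgraph_eq (V : finType) (a b : rel V) aS aI bS bI :
  a =2 b -> @unit_wgraph V a aS aI = @unit_wgraph V b bS bI.
Proof.
move=> eq_ab; have ab : a = b by apply/funext => u; apply/funext => v; exact: eq_ab.
by subst b; rewrite (Prop_irrelevance aS bS) (Prop_irrelevance aI bI).
Qed.

Definition unit_weighted G := forall u v : vert G, adj u v -> wt u v = 1.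

Definition triangle_free G :=
  forall u v w : vert G, adj u v -> adj v w -> adj u w = false.

Definition edge_connected G := forall X : pred (vert G),
  (forall u v, adj u v -> X u = X v) ->
  forall u v u' v', adj u v -> adj u' v' -> X u = X u'.

Definition degree_sum G := \sum_(u : vert G) \sum_(v : vert G) adj u v.

Section Transfer.
Variables (G H : wgraph) (r : nat).
Hypothesis iso_GH : wg_iso G (add_isolated H r).

Lemma iso_unit_weighted : unit_weighted H -> unit_weighted G.
Proof.
have [f [_ f_adj f_wt]] := iso_GH => unit_H u v uv; rewrite -f_wt //.
by move: uv; rewrite -f_adj; case: (f u) (f v) => [x|i] [y|j] //= /unit_H.
Qed.

Lemma iso_triangle_free : triangle_free H -> triangle_free G.
Proof.
have [f [_ f_adj _]] := iso_GH => no_triangle u v w; rewrite -!f_adj.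
by case: (f u) (f v) (f w) => [x|i] [y|j] [z|k] //=; exact: no_triangle.
Qed.

Lemma iso_edge_connected : edge_connected H -> edge_connected G.
Proof.
have [f [[f' fK f'K] f_adj _]] := iso_GH => conn_H X Xadj u v u' v' uv uv'.
rewrite -(fK u) -(fK u'); move: uv uv'; rewrite -2!f_adj.
case: (f u) (f v) (f u') (f v') => [x|i] [y|j] [x'|i'] [y'|j'] //= xy xy'.
apply: (conn_H (fun z => X (f' (inl z))) _ _ _ _ _ xy xy') => z t zt.
by apply: Xadj; rewrite -f_adj !f'K.
Qed.

Lemma iso_degree_sum : degree_sum G = degree_sum H.
Proof.
have [f [[f' fK f'K] f_adj _]] := iso_GH.
have f'_bij : bijective f' by exists f.
rewrite /degree_sum (reindex f') /=; last exact: onW_bij.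
rewrite big_sumType /= addnC big1 => [|i _].
  apply: eq_bigr => x _; rewrite (reindex f') /=; last exact: onW_bij.
  rewrite big_sumType /= addnC big1 => [|i _]; last by rewrite -f_adj !f'K.
  by apply: eq_bigr => y _; rewrite -f_adj !f'K.
by rewrite big1 // => v _; rewrite -f_adj f'K; case: (f v).
Qed.

End Transfer.

Lemma iso_add_isolated G H (e : vert G -> vert H) :
    injective e -> (forall x y, adj (e x) (e y) = adj x y) ->
    (forall x y, adj x y -> wt (e x) (e y) = wt x y) ->
    (forall u v, adj u v -> exists x, u = e x) ->
  exists r, wg_iso H (add_isolated G r).
Proof.
move=> e_inj e_adj e_wt e_all.
pose A := ~: [set e x | x in vert G].
pose f (x : vert G + 'I_#|A|) := match x with inl y => e y | inr i => enum_val i end.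
have eA x (i : 'I_#|A|) : e x <> enum_val i.
  by move=> ex; have := enum_valP i; rewrite -ex inE imset_f.
have f_inj : injective f.
  by move=> [x|i] [y|j] //= => [/e_inj->|/eA|/esym/eA|/enum_val_inj->].
have f_surj u : exists x, f x = u.
  case: (boolP (u \in A)) => [uA|].
    by exists (inr (enum_rank_in uA u)); rewrite /= enum_rankK_in.
  by rewrite inE negbK => /imsetP[x _ ->]; exists (inl x).
have [f' f'K] := choice f_surj.
have f_bij : bijective f by exists f' => // x; apply: f_inj; rewrite f'K.
have f_adj x y : adj (f x) (f y) = isol_adj x y.
  have adjA (i : 'I_#|A|) v : adj (enum_val i) v = false.
    by apply/negP => /e_all[z] /esym /eA.
  by case: x y => [x|i] [y|j] //=; rewrite ?e_adj ?adjA // adj_sym adjA.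
exists #|A|; apply: wg_iso_sym; exists f; split=> // x y.
by case: x y => [x|i] [y|j] //= /e_wt.
Qed.

End WeightedGraphs.

Section ForestGraph.
Variables (n : nat) (par : nat -> option nat).

Definition forest_rel (u v : 'I_n) : bool :=
  (u < v) && (par v == Some (val u)) || (v < u) && (par u == Some (val v)).

Lemma forest_rel_sym : symmetric forest_rel.
Proof. by move=> u v; rewrite /forest_rel orbC. Qed.

Lemma forest_rel_irr : irreflexive forest_rel.
Proof. by move=> u; rewrite /forest_rel ltnn. Qed.

Definition forest_graph : wgraph := unit_wgraph forest_rel_sym forest_rel_irr.

Definition has_parent v := if par v is Some u then u < v else false.

Definition num_edges p := count has_parent (iota 0 p).

Definition edge_free_cut p := forall u v, u < p <= v -> v < n -> par v <> Some u.

(* Connectivity is only needed across the cuts at initial segments. *)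
Definition one_component := forall p, p <= n -> edge_free_cut p ->
  (num_edges p == 0) || (num_edges p == num_edges n).

Lemma forest_rel_ltn (u v : 'I_n) : u < v -> forest_rel u v = (par v == Some (val u)).
Proof. by rewrite /forest_rel => uv; rewrite uv ltnNge (ltnW uv) orbF. Qed.

Lemma forest_rel_has_parent (u v : 'I_n) : u < v -> forest_rel u v -> has_parent v.
Proof. by move=> uv; rewrite forest_rel_ltn // /has_parent => /eqP ->. Qed.

Lemma has_parentP v : v < n -> reflect (exists u v' : 'I_n, [/\ u < v', v = v' & forest_rel u v'])
  (has_parent v).
Proof.
move=> vn; apply: (iffP idP) => [|[u [v' [uv -> /(forest_rel_has_parent uv)]]]] //.
rewrite /has_parent; case E : (par v) => [u|] // uv.
exists (Ordinal (ltn_trans uv vn)), (Ordinal vn).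
by rewrite forest_rel_ltn //= E.
Qed.

Lemma forest_triangle_free : triangle_free forest_graph.
Proof.
move=> u v w /= uv vw; apply/negP => uw.
have not_two (x y z : 'I_n) : x < y < z -> forest_rel x z -> ~~ forest_rel y z.
  move=> /andP[xy yz]; rewrite !forest_rel_ltn ?(ltn_trans xy) // => /eqP ->.
  by apply/eqP => -[]; lia.
have ne (x y : 'I_n) : forest_rel x y -> x != y :> nat.
  by case: (eqVneq (val x) y) => // /val_inj ->; rewrite forest_rel_irr.
have [vu wv wu] : [/\ forest_rel v u, forest_rel w v & forest_rel w u].
  by split; rewrite forest_rel_sym.
have [[uv' vw'] uw'] := (ne _ _ uv, ne _ _ vw, ne _ _ uw).
have := not_two u v w; have := not_two v u w; have := not_two u w v.
have := not_two w u v; have := not_two v w u; have := not_two w v u.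
by rewrite uv vw uw vu wv wu; lia.
Qed.

Lemma sum_parent (v : 'I_n) :
  \sum_(u < n) (u < v) && (par v == Some (val u)) = has_parent v.
Proof.
rewrite /has_parent; case: (par v) => [u0|]; last by rewrite big1 // => u _; rewrite andbF.
case: (ltnP u0 v) => [u0v|vu0].
  rewrite (bigD1 (Ordinal (ltn_trans u0v (ltn_ord v)))) //= u0v eqxx big1 // => u.
  by rewrite -val_eqE /= => uu0; case: eqP => [[e]|]; lia.
by rewrite big1 // => u _; case: eqP => [[e]|]; lia.
Qed.

Lemma degree_sum_forest : degree_sum forest_graph = (num_edges n).*2.
Proof.
rewrite /degree_sum /= -addnn.
under eq_bigr => u _.
  under eq_bigr => v _.
    rewrite /forest_rel (_ : nat_of_bool _ =
      (u < v) && (par v == Some (val u)) + (v < u) && (par u == Some (val v))); last by lia.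
    over.
  rewrite big_split /=; over.
rewrite big_split /= exchange_big /=.
by under eq_bigr => v _ do rewrite sum_parent; rewrite -count_iota -/(num_edges n).
Qed.

Lemma edge_connected_one_component : edge_connected forest_graph -> one_component.
Proof.
move=> conn p pn cut.
have -> : num_edges n = num_edges p + count has_parent (iota p (n - p)).
  by rewrite /num_edges -count_cat -iotaD subnKC.
rewrite /num_edges; case: (boolP (has has_parent (iota 0 p))) => [/hasP[v]|]; last first.
  by rewrite has_count; lia.
rewrite mem_iota => /andP[_ vp] /(has_parentP (leq_trans vp pn))[u0 [v0 [uv0 ev uv0_edge]]].
case: (boolP (has has_parent (iota p (n - p)))) => [/hasP[w]|]; last first.
  by rewrite has_count; lia.
rewrite mem_iota => /andP[pw wn].
have /has_parentP/[apply] : w < n by lia.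
move=> [u1 [w0 [uw1 ew uw1_edge]]].
have no_cross (x y : 'I_n) : x < p <= y -> forest_rel x y = false.
  move=> xpy; rewrite forest_rel_ltn; last by lia.
  by apply/eqP/cut.
have side (x y : 'I_n) : forest_rel x y -> (x < p) = (y < p).
  by move=> e; have := no_cross x y; have := no_cross y x; rewrite forest_rel_sym e; lia.
have := conn (fun x => val x < p) side _ _ _ _ uv0_edge uw1_edge.
by move: vp pw; rewrite ev ew /= (side _ _ uw1_edge); lia.
Qed.

End ForestGraph.

Definition rooted_tree m par := forall v, 0 < v <= m -> has_parent par v.

Lemma num_edges_rooted_tree m par :
  rooted_tree m par -> num_edges par m.+1 = m.
Proof.
move=> tree; rewrite /num_edges /= [has_parent par 0](_ : _ = false); last first.
  by rewrite /has_parent; case: (par 0).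
rewrite add0n -[RHS](size_iota 1 m); apply/eqP; rewrite -all_count.
by apply/allP => v; rewrite mem_iota => /tree.
Qed.

Lemma rooted_tree_edge_connected m par :
  rooted_tree m par -> edge_connected (forest_graph m.+1 par).
Proof.
move=> tree X Xedge u _ u' _ _ _; suff X0 : forall v : 'I_m.+1, X v = X ord0 by rewrite !X0.
move=> [v]; elim/ltn_ind: v => v IH vm.
case: (posnP v) => [v0|v_gt0]; first by congr X; exact: val_inj.
have /(has_parentP par vm)[w [v' [wv ev edge]]] : has_parent par v by apply: tree; lia.
have -> : Ordinal vm = v' by exact: val_inj.
by rewrite -(Xedge _ _ edge); case: w {edge} wv => w wm /= wv; apply: IH; lia.
Qed.

Definition path_tree (v : nat) : option nat := if v is u.+1 then Some u else None.

Definition star_tree (v : nat) : option nat := if v is _.+1 then Some 0 else None.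

Lemma path_graphE m : path_graph m = forest_graph m.+1 path_tree.
Proof.
apply: unit_wgraph_eq => u v; rewrite /path_adj /forest_rel.
by case: u v => [[|u] um] [[|v] vm] //=; rewrite !(inj_eq (@Some_inj _)); lia.
Qed.

Lemma star_graphE m : star_graph m = forest_graph m.+1 star_tree.
Proof.
apply: unit_wgraph_eq => u v; rewrite /star_adj /forest_rel -!val_eqE.
by case: u v => [[|u] um] [[|v] vm] //=; rewrite !(inj_eq (@Some_inj _)); lia.
Qed.

Lemma path_tree_rooted m : rooted_tree m path_tree.
Proof. by case=> //= v _; rewrite /has_parent /=. Qed.

Lemma star_tree_rooted m : rooted_tree m star_tree.
Proof. by case. Qed.

Section ForestTree.
Variables (n m : nat) (par tree : nat -> option nat).
Hypothesis tree_rooted : rooted_tree m tree.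

Lemma iso_tree_num_edges r :
  wg_iso (forest_graph n par) (add_isolated (forest_graph m.+1 tree) r) -> num_edges par n = m.
Proof.
by move=> /iso_degree_sum; rewrite !degree_sum_forest num_edges_rooted_tree // => /double_inj.
Qed.

Lemma iso_tree_one_component r :
  wg_iso (forest_graph n par) (add_isolated (forest_graph m.+1 tree) r) -> one_component n par.
Proof.
move=> iso; apply: edge_connected_one_component.
exact: iso_edge_connected iso (rooted_tree_edge_connected tree_rooted).
Qed.

Variable root : nat.
Let nodes := [seq v <- iota 0 n | has_parent par v].
Let node := nth 0 (root :: nodes).
Hypotheses (m_gt0 : 0 < m) (size_nodes : size nodes = m)
  (par_node : forall i j, j < m -> tree j.+1 = Some i -> par (node j.+1) = Some (node i)).

Let root_lt : root < nth 0 nodes 0.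
Proof.
have tree1 : tree 1 = Some 0.
  have : has_parent tree 1 by apply: tree_rooted.
  by rewrite /has_parent; case: (tree 1) => [[|]|].
have : nth 0 nodes 0 \in nodes by rewrite mem_nth ?size_nodes.
by rewrite mem_filter /has_parent (par_node m_gt0 tree1) => /andP[].
Qed.

Let nodes_sorted : sorted ltn (root :: nodes).
Proof.
have : sorted ltn nodes by apply: sorted_filter (iota_ltn_sorted 0 n); exact: ltn_trans.
by move: root_lt size_nodes m_gt0; rewrite /=; case: nodes => [|v l] /= => [_ <-|->].
Qed.

Let node_lt (i : 'I_m.+1) : node i < n.
Proof.
have : node i \in root :: nodes by rewrite mem_nth //= size_nodes ltn_ord.
have nodes_lt v : v \in nodes -> v < n by rewrite mem_filter mem_iota => /and3P[].
rewrite inE => /predU1P[->|/nodes_lt //].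
by apply: ltn_trans root_lt (nodes_lt _ _); rewrite mem_nth ?size_nodes.
Qed.

Let node_ltn (i j : 'I_m.+1) : (node i < node j) = (i < j).
Proof.
have node_homo (k l : 'I_m.+1) : k < l -> node k < node l.
  move=> kl; apply: (sorted_ltn_nth ltn_trans 0 nodes_sorted) => //;
    by rewrite inE /= size_nodes ltn_ord.
by case: (ltngtP i j) => [/node_homo //|/node_homo|->]; [lia | rewrite ltnn].
Qed.

Let embed (i : 'I_m.+1) : 'I_n := Ordinal (node_lt i).

Let embed_inj : injective embed.
Proof.
move=> i j /(congr1 val) /= eq_ij; have := node_ltn i j; have := node_ltn j i.
by rewrite eq_ij ltnn => ji ij; apply: ord_inj; lia.
Qed.

Let par_embed (j : 'I_m.+1) : 0 < j ->
  exists2 i : 'I_m.+1, tree j = Some (val i) & par (embed j) = Some (val (embed i)).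
Proof.
case: j => [[|j] jm] //= _; have : has_parent tree j.+1 by apply: tree_rooted; lia.
rewrite /has_parent; case Ej : (tree j.+1) => [i|] // ij.
by exists (Ordinal (ltn_trans ij jm)) => //=; apply: par_node.
Qed.

Let embed_forest_rel i j : forest_rel par (embed i) (embed j) = forest_rel tree i j.
Proof.
wlog ij : i j / i < j => [wlog_ij|].
  case: (ltngtP i j) => [||/val_inj ->]; first exact: wlog_ij.
    by rewrite forest_rel_sym [RHS]forest_rel_sym; exact: wlog_ij.
  by rewrite !forest_rel_irr.
rewrite !forest_rel_ltn //; last by rewrite /= node_ltn.
have [|k -> ->] := @par_embed j; first by lia.
by rewrite !(inj_eq (@Some_inj _)) !val_eqE (inj_eq embed_inj).
Qed.

Lemma forest_iso_tree :
  exists r, wg_iso (forest_graph n par) (add_isolated (forest_graph m.+1 tree) r).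
Proof.
apply: (@iso_add_isolated (forest_graph m.+1 tree) (forest_graph n par) embed) => [||//|].
- exact: embed_inj.
- exact: embed_forest_rel.
move=> u v; suff both (x y : 'I_n) : x < y -> forest_rel par x y ->
    (exists i, x = embed i) /\ (exists j, y = embed j).
  case: (ltngtP u v) => [uv /both[]|vu|/val_inj ->] //=; last by rewrite forest_rel_irr.
  by rewrite forest_rel_sym => /both[].
move=> xy edge; have y_node : val y \in nodes.
  by rewrite mem_filter mem_iota (forest_rel_has_parent xy edge) /=.
have ym : index (val y) nodes < m by rewrite -size_nodes index_mem.
pose j : 'I_m.+1 := Ordinal (ym : (index (val y) nodes).+1 < m.+1).
have y_embed : y = embed j by apply: val_inj; rewrite /= /node /= nth_index.
split; last by exists j.
have [//|i _ par_y] := @par_embed j.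
exists i; move: edge; rewrite forest_rel_ltn // y_embed par_y => /eqP[e].
exact: val_inj.
Qed.

End ForestTree.

Section Competition.
Variables (n : nat) (s : 'S_n).

Lemma unit_weighted_common_out : unit_weighted (competition_graph s) ->
  forall u v, u != v -> #|common_out s u v| <= 1.
Proof.
move=> unit_s u v uv; case: (posnP #|common_out s u v|) => [->//|].
by rewrite card_gt0 => common; rewrite [#|_|]unit_s //=; apply/andP.
Qed.

Lemma competition_forest (phi : 'I_n -> 'I_n) (par : nat -> option nat) :
    bijective phi ->
    (forall u v : 'I_n, u < v -> #|common_out s (phi u) (phi v)| = (par v == Some (val u))) ->
  wg_iso (competition_graph s) (forest_graph n par).
Proof.
move=> phi_bij common; apply: wg_iso_sym.
have weight_rel u v : u != v -> #|common_out s (phi u) (phi v)| = forest_rel par u v.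
  rewrite neq_ltn => /orP[uv|vu]; first by rewrite common // forest_rel_ltn.
  by rewrite common_outC common // forest_rel_sym forest_rel_ltn.
exists phi; split=> // u v.
  rewrite /= /comp_adj -card_gt0 (inj_eq (bij_inj phi_bij)).
  by case: (eqVneq u v) => [->|uv] /=; rewrite ?forest_rel_irr // weight_rel // lt0b.
move=> /= uv; rewrite /comp_wt weight_rel ?uv //.
by apply: contraTneq uv => ->; rewrite forest_rel_irr.
Qed.

End Competition.

(** * Paths and avoidance of 123 *)

Section TrailingZeros.
Variable c : nat -> nat.

Fixpoint trailing_zeros p :=
  if p is q.+1 then if c q == 0 then (trailing_zeros q).+1 else 0 else 0.

Definition zeros_between u v := count (fun x => c x == 0) (iota u.+1 (v - u.+1)).

(* Junk value 0 when all letters before [p] are zeros. *)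
Definition prev_nonzero p := p - (trailing_zeros p).+1.

Definition contact p := c p == (trailing_zeros p).+1.

Definition contacts p := count contact (iota 0 p).

Definition contact_parent p := if contact p then Some (prev_nonzero p) else None.

Definition linear_forest_code n := forall p, p < n ->
  c p <= (trailing_zeros p).+1 /\ (contact p -> 0 < trailing_zeros (prev_nonzero p)).

Lemma trailing_zerosP p i : p - trailing_zeros p <= i < p -> c i = 0.
Proof.
elim: p => //= p IH; case: eqP => [c0|_]; last by lia.
rewrite subSS ltnS [i <= p]leq_eqVlt => /andP[zi] /predU1P[-> //|ip].
by apply: IH; rewrite zi.
Qed.

Lemma prev_nonzero_gt0 p : trailing_zeros p < p -> 0 < c (prev_nonzero p).
Proof.
rewrite /prev_nonzero; elim: p => //= p IH; case: eqP => [_|c0]; last by rewrite subn1 /=; lia.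
by rewrite subSS ltnS => /IH.
Qed.

Lemma prev_nonzero_lt p : trailing_zeros p < p -> prev_nonzero p < p.
Proof. by rewrite /prev_nonzero; lia. Qed.

Lemma leq_prev_nonzero u p : u < p -> 0 < c u -> (trailing_zeros p < p) && (u <= prev_nonzero p).
Proof.
rewrite /prev_nonzero => up cu; case: (ltnP u (p - trailing_zeros p)) => [|zu]; first by lia.
by have := @trailing_zerosP p u; lia.
Qed.

Lemma zeros_between_cat u w v : u < w -> w < v -> 0 < c w ->
  zeros_between u v = zeros_between u w + zeros_between w v.
Proof.
move=> uw wv cw; rewrite /zeros_between.
have -> : v - u.+1 = (w - u.+1) + (v - w.+1).+1 by lia.
by rewrite iotaD count_cat subnKC //= gtn_eqF.
Qed.

Lemma zeros_between_prev p : trailing_zeros p < p ->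
  zeros_between (prev_nonzero p) p = trailing_zeros p.
Proof.
rewrite /prev_nonzero /zeros_between => zp.
have -> : (p - (trailing_zeros p).+1).+1 = p - trailing_zeros p by lia.
rewrite subKn ?(ltnW zp) //; apply/eqP; rewrite -[X in _ == X](size_iota (p - trailing_zeros p)).
rewrite -all_count; apply/allP => i; rewrite mem_iota => zi.
by apply/eqP/(@trailing_zerosP p); lia.
Qed.

Lemma trailing_zeros_le_between u p : u < p -> 0 < c u -> trailing_zeros p <= zeros_between u p.
Proof.
move=> up cu; have /andP[zp] := leq_prev_nonzero up cu.
rewrite leq_eqVlt => /predU1P[->|uw]; first by rewrite zeros_between_prev.
rewrite (zeros_between_cat uw) ?zeros_between_prev ?leq_addl //; last exact: prev_nonzero_gt0.
by rewrite /prev_nonzero; lia.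
Qed.

Lemma contactsS p : contacts p.+1 = contacts p + contact p.
Proof. exact: count_iotaS. Qed.

Lemma contacts_gap u p : u < p -> (forall x, u < x < p -> c x = 0) ->
  contacts p = contacts u + contact u.
Proof.
rewrite /contacts => up gap; have -> : p = u + (p - u.+1).+1 by lia.
rewrite iotaD count_cat /=; congr (_ + _); rewrite -[RHS]addn0; congr (_ + _).
apply/eqP; rewrite -leqn0 leqNgt -has_count; apply/hasPn => x; rewrite mem_iota => ux.
by rewrite /contact gap //; lia.
Qed.

Lemma contacts_prev p : trailing_zeros p < p ->
  contacts p = contacts (prev_nonzero p) + contact (prev_nonzero p).
Proof.
move=> zp; apply: contacts_gap => [|x]; first exact: prev_nonzero_lt.
by rewrite /prev_nonzero => ux; apply: (@trailing_zerosP p); lia.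
Qed.

Lemma path_trace p :
  trace path_next (0, 0) c p = (contacts p, trailing_zeros p).
Proof. by elim: p => // p IH; rewrite traceS IH contactsS. Qed.

Hypothesis c_le : forall p, c p <= p.

Lemma contact_trailing_zeros p : contact p -> trailing_zeros p < p.
Proof. by rewrite /contact => /eqP cp; have := c_le p; lia. Qed.

Lemma contact_has_parent p : has_parent contact_parent p = contact p.
Proof.
rewrite /has_parent /contact_parent; case: ifP => // cp.
by rewrite prev_nonzero_lt ?contact_trailing_zeros.
Qed.

Lemma num_edges_contact p : num_edges contact_parent p = contacts p.
Proof. by apply: eq_count => v; exact: contact_has_parent. Qed.

Section Letters.
Variables m n : nat.

Lemma linear_forest_path_legal : linear_forest_code n -> contacts n = m ->
  one_component n contact_parent ->
  forall p, p < n -> path_legal m (contacts p, trailing_zeros p) (c p).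
Proof.
move=> linear total comp p pn.
have cut q : q <= n -> edge_free_cut n contact_parent q -> (contacts q == 0) || (contacts q == m).
  by move=> qn /(comp q qn); rewrite !num_edges_contact total.
have [c_le_z _] := linear p pn.
rewrite /path_legal /=; case: (posnP (c p)) => //= c_gt0.
have cut_prev v : p < v -> p <= prev_nonzero v.
  by move=> pv; have /andP[] := leq_prev_nonzero pv c_gt0.
case: (leqP (c p) (trailing_zeros p)) => /= [short|touch].
  rewrite cut // => [|u v /andP[up]]; first exact: ltnW.
  rewrite leq_eqVlt => /predU1P[<-|pv] _; rewrite /contact_parent.
    by rewrite /contact (_ : _ == _ = false) //; lia.
  by case: ifP => // _ [eu]; have := cut_prev v pv; lia.
have cp : contact p by rewrite /contact; lia.
have pS : contacts p.+1 = (contacts p).+1 by rewrite contactsS cp addn1.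
have lt_m : contacts p < m by rewrite -pS -total; exact: leq_count_iota.
rewrite -/(contact p) cp lt_m /=.
case: (posnP (trailing_zeros p)) => [z0|_]; rewrite ?orbT ?orbF //.
suff : (contacts p.+1 == 0) || (contacts p.+1 == m) by rewrite pS; lia.
apply: cut => // u v /andP[up pv] vn; rewrite /contact_parent; case: ifP => // cv [eu].
have [_ /(_ cv)] := linear v vn; have := cut_prev v pv.
by move=> le_p; have -> : prev_nonzero v = p; [lia | rewrite z0].
Qed.

Hypothesis legal : forall p, p < n -> path_legal m (contacts p, trailing_zeros p) (c p).

Lemma path_legal_le p : p < n -> c p <= (trailing_zeros p).+1.
Proof. by move=> pn; have := legal pn; rewrite /path_legal /=; lia. Qed.

Lemma path_legal_lt p : p < n -> contact p -> contacts p < m.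
Proof. by move=> pn; have := legal pn; rewrite /path_legal /contact /=; lia. Qed.

Lemma path_legal_contact_prev p : p < n -> contact p -> 0 < contacts p -> contact (prev_nonzero p).
Proof.
move=> pn cp k_gt0; have zp := contact_trailing_zeros cp.
have := contacts_prev zp.
have := prev_nonzero_gt0 zp; have lt_m := path_legal_lt pn cp.
have : prev_nonzero p < n by apply: ltn_trans (prev_nonzero_lt zp) pn.
by move/legal; rewrite /path_legal /contact /=; lia.
Qed.

Lemma path_legal_linear : linear_forest_code n.
Proof.
move=> p pn; split=> [|cp]; first exact: path_legal_le.
have zp := contact_trailing_zeros cp.
rewrite lt0n; apply/eqP => z0; have lt_m := path_legal_lt pn cp.
have un := ltn_trans (prev_nonzero_lt zp) pn.
have c1 : contact (prev_nonzero p).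
  by have := prev_nonzero_gt0 zp; have := path_legal_le un; rewrite /contact z0; lia.
have := legal un; have := contacts_prev zp; rewrite c1.
by move: c1; rewrite /contact /path_legal /= z0; lia.
Qed.

Hypothesis total : contacts n = m.

Lemma path_legal_iso_path : 0 < m ->
  exists r, wg_iso (forest_graph n contact_parent) (add_isolated (path_graph m) r).
Proof.
move=> m_gt0; rewrite path_graphE; set nodes := [seq v <- iota 0 n | contact v].
have nodesE : [seq v <- iota 0 n | has_parent contact_parent v] = nodes.
  by apply: eq_filter => v; exact: contact_has_parent.
have size_nodes : size nodes = m by rewrite size_filter.
have node_contact j : j < m -> [/\ nth 0 nodes j < n, contact (nth 0 nodes j)
    & contacts (nth 0 nodes j) = j].
  by move=> jm; apply: nth_filter_iotaP; rewrite -/(contacts n) total.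
have prev_node j : j.+1 < m -> prev_nonzero (nth 0 nodes j.+1) = nth 0 nodes j.
  move=> jm; have [jn cj kj] := node_contact _ jm.
  have prev_contact : contact (prev_nonzero (nth 0 nodes j.+1)).
    by apply: path_legal_contact_prev; rewrite ?kj.
  have zp := contact_trailing_zeros cj.
  have := contacts_prev zp; rewrite kj prev_contact addn1 => -[ej].
  by rewrite [in RHS]ej nth_filter_iota // (ltn_trans (prev_nonzero_lt zp)).
apply: (@forest_iso_tree _ _ _ _ (@path_tree_rooted m) (prev_nonzero (nth 0 nodes 0)));
  rewrite ?nodesE // => i j jm /= [<-].
have [_ cj _] := node_contact j jm; rewrite /contact_parent cj.
by case: j jm {cj} => // j jm; rewrite prev_node.
Qed.

End Letters.

End TrailingZeros.

Section CommonBelow.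
Variables (g : nat -> nat) (n : nat).
Hypothesis g_inj : injective g.
Let c := lehmer g.

Definition avoids123 :=
  forall x y w, x < y -> y < w -> w < n -> g x < g y -> g w <= g y.

(* For [u < v], the number of common out-neighbours of [u] and [v]. *)
Definition common_below u v := count (fun x => (g x < g u) && (g x < g v)) (iota 0 u).

(* A non-minimum [x] below [p] would lie above some [y], and the trailing zeros
   would all be below [p] too, making [c p] too large. *)
Lemma below_lehmer0 p x : c p <= (trailing_zeros c p).+1 -> x < p -> g x < g p -> c x = 0.
Proof.
move=> c_le_z xp gx; apply/eqP; rewrite -[_ == 0]negbK -lt0n; apply/negP => cx.
have [y yx gy] := lehmer_gt0P _ _ cx.
have zero i : p - trailing_zeros c p <= i < p -> c i = 0 by exact: trailing_zerosP.
have xz : x < p - trailing_zeros c p by rewrite ltnNge; apply/negP => zx; have := zero x; lia.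
suff : size [:: y, x & iota (p - trailing_zeros c p) (trailing_zeros c p)] <= c p.
  by rewrite /= size_iota; lia.
apply: leq_lehmer => /=.
  by rewrite !inE !mem_iota iota_uniq; lia.
rewrite gx (ltn_trans gy gx) xp (ltn_trans yx xp) /=.
apply/allP => i; rewrite mem_iota => zi; have ip : i < p by lia.
by rewrite ip (ltn_trans _ gx) // (ltn_of_lehmer0 g_inj) //; [apply: zero|]; lia.
Qed.

Lemma small_lehmer_avoids123 :
  (forall p, p < n -> c p <= (trailing_zeros c p).+1) -> avoids123.
Proof.
move=> near x y w xy yw wn gxy; rewrite leqNgt; apply/negP => gyw.
have /lehmer_gt0P : exists2 i, i < y & g i < g y by exists x.
by rewrite -/(c y) (below_lehmer0 (near w wn) yw gyw).
Qed.

Hypothesis avoid : avoids123.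

Lemma below_nonzero u v x : u < v -> v < n -> 0 < c u -> g x < g v -> g x < g u.
Proof. by move=> uv vn /lehmer_gt0P[y yu gy] gx; have := avoid yu uv vn gy; lia. Qed.

Lemma common_below_lehmer0 u v : c u = 0 -> common_below u v = 0.
Proof.
move=> cu; apply/eqP; rewrite -leqn0 -[leqRHS]cu /c lehmerE.
by apply: sub_count => x /andP[].
Qed.

(* Every non-minimum [u] lies above all the entries below [v], hence the entries
   below [v] between [u] and [v] are minima; they are all the minima there as
   soon as some entry before [u] is below [v]. *)
Lemma common_belowE u v : u < v -> v < n -> 0 < c u ->
  common_below u v = c v - zeros_between c u v.
Proof.
move=> uv vn cu; pose between := count (fun x => g x < g v) (iota u.+1 (v - u.+1)).
have common_lehmer : c v = common_below u v + between.
  have -> : common_below u v = count (fun x => g x < g v) (iota 0 u).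
    apply: eq_in_count => x _; case: (ltnP (g x) (g v)) => gx; rewrite ?andbF ?andbT //.
    exact: below_nonzero gx.
  have gu : (g u < g v) = false by apply/negP => /(below_nonzero uv vn cu); rewrite ltnn.
  rewrite /c lehmerE (_ : iota 0 v = iota 0 u ++ u :: iota u.+1 (v - u.+1)).
    by rewrite count_cat /= gu.
  by rewrite -[_ :: _]/(iota u (v - u.+1).+1) -iotaD; congr iota; lia.
have between_zero x : u < x < v -> g x < g v -> c x = 0.
  move=> ux gx; apply/eqP; rewrite -leqn0 leqNgt; apply/negP => /lehmer_gt0P[y yx gy].
  by have := avoid yx _ vn gy; lia.
case: (posnP (common_below u v)) => [no_common|].
  suff : between <= zeros_between c u v by lia.
  rewrite /between /zeros_between -!size_filter; apply: uniq_leq_size.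
    by rewrite filter_uniq ?iota_uniq.
  move=> x; rewrite !mem_filter mem_iota => /andP[gx ux].
  by rewrite ux between_zero //; lia.
rewrite -has_count => /hasP[y]; rewrite mem_iota => yu /andP[_ gy].
suff : between = zeros_between c u v by lia.
apply: eq_in_count => x; rewrite mem_iota => ux; apply/idP/eqP => [gx|cx].
  by apply: between_zero => //; lia.
by apply: ltn_trans gy; apply: ltn_of_lehmer0 => //; lia.
Qed.

Lemma unit_triangle_free_linear :
    (forall u v, u < v -> v < n -> common_below u v <= 1) ->
    (forall u v w, u < v -> v < w -> w < n ->
      0 < common_below u v -> 0 < common_below v w -> common_below u w = 0) ->
  linear_forest_code c n.
Proof.
move=> weight_le1 no_triangle.
have common_prev p : p < n -> trailing_zeros c p < p ->
    common_below (prev_nonzero c p) p = c p - trailing_zeros c p.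
  by move=> pn zp; rewrite common_belowE ?zeros_between_prev ?prev_nonzero_gt0 ?prev_nonzero_lt.
have near p : p < n -> c p <= (trailing_zeros c p).+1.
  move=> pn; case: (ltnP (trailing_zeros c p) p) => [zp|pz].
    by have := weight_le1 _ _ (prev_nonzero_lt zp) pn; rewrite common_prev //; lia.
  by have := lehmer_le g p; rewrite -/(c p); lia.
move=> p pn; split=> [|contact_p]; first exact: near.
have zp := contact_trailing_zeros (lehmer_le g) contact_p.
rewrite lt0n; apply/eqP; set u := prev_nonzero c p => zu.
have cu : 0 < c u by exact: prev_nonzero_gt0.
have up : u < p by exact: prev_nonzero_lt.
have zu_lt : trailing_zeros c u < u by have := lehmer_le g u; rewrite -/(c u); lia.
set t := prev_nonzero c u; have tu : t < u by exact: prev_nonzero_lt.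
have ct : 0 < c t by exact: prev_nonzero_gt0.
have := no_triangle t u p tu up pn; rewrite !common_prev //; last exact: ltn_trans pn.
rewrite common_belowE ?(ltn_trans tu) // (zeros_between_cat tu) // !zeros_between_prev //.
by rewrite (eqP contact_p); lia.
Qed.

Lemma linear_common_below u v : linear_forest_code c n -> u < v -> v < n ->
  common_below u v = (contact_parent c v == Some u).
Proof.
move=> linear uv vn; have [near contact_prev] := linear v vn.
case: (posnP (c u)) => cu.
  rewrite common_below_lehmer0 // /contact_parent; case: ifP => // /eqP cv.
  rewrite (inj_eq (@Some_inj _)); case: eqP => // eu.
  by have := @prev_nonzero_gt0 c v; have := lehmer_le g v; rewrite -/(c v) eu; lia.
have /andP[zv le_prev] := leq_prev_nonzero uv cu; have cw := prev_nonzero_gt0 zv.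
rewrite common_belowE // /contact_parent; move: le_prev.
rewrite leq_eqVlt => /predU1P[->|u_prev].
  rewrite zeros_between_prev //; case: ifP => [/eqP ->|]; first by rewrite eqxx subSnn.
  by rewrite /contact /=; lia.
have prev_v := prev_nonzero_lt zv.
rewrite (zeros_between_cat u_prev) // zeros_between_prev //.
have := trailing_zeros_le_between u_prev cu; move: contact_prev; rewrite /contact.
case: (eqVneq (c v)) => [cv /(_ isT)|cv _] /=; last by lia.
by rewrite (inj_eq (@Some_inj _)); case: eqP; lia.
Qed.

End CommonBelow.

Lemma card_common_out n (s : 'S_n) (u v : 'I_n) : u < v ->
  #|common_out s u v| = common_below (perm_fun s) u v.
Proof.
move=> uv; rewrite /common_below -(count_iota_ltn _ (ltnW (ltn_ord u))) -card_ord_count.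
congr #|pred_of_set _|; apply/setP => x.
by rewrite !inE /darc !perm_funE; lia.
Qed.

(** * Stars and avoidance of 132 *)

Section StarCode.
Variable c : nat -> nat.

(* If [0 < c p], the root of the tree of [p] in the plane forest with depths [c].
   Junk value 0 at [p = 0]. *)
Fixpoint root p := if p is q.+1 then if c q == 0 then q else root q else 0.

Definition star_parent n v := if (v.+1 < n) && (c v.+1 == 2) then Some (root v) else None.

Definition star_forest_code n :=
  forall p, p < n -> c p <= 2 /\ (c p = 2 -> c p.-1 = 1).

Lemma root_last p x : root p < x < p -> 0 < c x.
Proof.
elim: p => [|p IH] /=; first by lia.
case: eqP => [_|cp]; first by lia.
move=> /andP[rx]; rewrite ltnS leq_eqVlt => /predU1P[->|xp]; first by lia.
by apply: IH; rewrite rx.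
Qed.

Lemma root_const u v : u <= v -> (forall x, u <= x < v -> 0 < c x) -> root v = root u.
Proof.
elim: v => [|v IH]; first by rewrite leqn0 => /eqP ->.
rewrite leq_eqVlt => /predU1P[-> //|uv] nonzero /=; rewrite gtn_eqF; last by apply: nonzero; lia.
by apply: IH => // x ux; apply: nonzero; lia.
Qed.

Lemma root_geq u v : u < v -> c u = 0 -> u <= root v.
Proof. by move=> uv cu; rewrite leqNgt; apply/negP => ru; have := @root_last v u; lia. Qed.

Hypothesis c_le : forall p, c p <= p.

Let c_at0 : c 0 = 0. Proof. by have := c_le 0; lia. Qed.

Lemma root_lt p : 0 < p -> root p < p.
Proof.
elim: p => //= p IH _; case: eqP => // cp.
by case: p IH cp => [|p] IH cp; [rewrite c_at0 in cp | apply: ltnW; apply: IH].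
Qed.

Lemma root_lehmer0 p : c (root p) = 0.
Proof. by elim: p => //= p IH; case: eqP. Qed.

Lemma star_has_parent n v : has_parent (star_parent n) v = (v.+1 < n) && (c v.+1 == 2).
Proof.
rewrite /has_parent /star_parent; case: ifP => // /andP[_ /eqP c2].
by apply: root_lt; have := c_le v.+1; lia.
Qed.

Definition twos p := count (fun x => c x == 2) (iota 0 p).

Lemma twosS p : twos p.+1 = twos p + (c p == 2).
Proof. exact: count_iotaS. Qed.

Lemma star_trace p : trace star_next (0, 0) c p = (twos p, c p.-1).
Proof.
elim: p => [|p IH]; first by rewrite /trace /= c_at0.
by rewrite traceS IH twosS.
Qed.

Lemma num_edges_star n p : p <= n -> num_edges (star_parent n) p = twos (minn p.+1 n).
Proof.
elim: p => [|p IH] pn.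
  by case: n pn => [|n] _; rewrite ?minn0 // (minn_idPl (ltn0Sn n)) /twos /= c_at0.
rewrite /num_edges count_iotaS -/(num_edges _ _) IH ?(ltnW pn) // star_has_parent (minn_idPl pn).
case: (ltnP p.+1 n) => [pn'|np]; first by rewrite (minn_idPl pn') [RHS]twosS.
by rewrite (minn_idPr (leqW np)) addn0; congr twos; lia.
Qed.

Section Letters.
Variables m n : nat.

Lemma star_forest_star_legal : star_forest_code n -> twos n = m ->
    one_component n (star_parent n) ->
  forall p, p < n -> star_legal m (twos p, c p.-1) (c p).
Proof.
move=> star total comp p pn; have [c_le2 prev1] := star p pn.
have le_m : twos p.+1 <= m by rewrite -total; exact: leq_count_iota.
rewrite twosS in le_m; rewrite /star_legal /=.
case: (posnP (c p)) => [cp|]; last by have := prev1; lia.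
have cut : edge_free_cut n (star_parent n) p -> (twos p == 0) || (twos p == m).
  move/(comp p (ltnW pn)); rewrite !num_edges_star ?(ltnW pn) // (minn_idPl pn).
  by rewrite (minn_idPr (leqnSn n)) total twosS cp addn0.
rewrite cut // => u v /andP[up pv] _.
rewrite /star_parent; case: ifP => // /andP[vn /eqP c2] [eu].
have [_ /(_ c2) /= c1] := star _ vn.
have pv' : p < v by case: ltngtP pv => // e; rewrite -e cp in c1.
by have := root_geq pv' cp; lia.
Qed.

Hypothesis legal : forall p, p < n -> star_legal m (twos p, c p.-1) (c p).

Lemma star_legal_star_forest : star_forest_code n.
Proof. by move=> p pn; have := legal pn; rewrite /star_legal /=; lia. Qed.

Hypothesis total : twos n = m.

Lemma star_legal_same_root u v : u < v ->
  has_parent (star_parent n) u -> has_parent (star_parent n) v -> root v = root u.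
Proof.
rewrite !star_has_parent => uv /andP[un /eqP cu] /andP[vn /eqP cv].
apply: root_const => [|x /andP[]]; first exact: ltnW.
rewrite leq_eqVlt => /predU1P[<- _|ux xv].
  by have [_ /(_ cu) /= ->] := star_legal_star_forest un.
rewrite lt0n; apply/eqP => cx.
have neq_ux : u.+1 != x by apply: contra_eq_neq cx => <-; rewrite cu.
have twos_gt0 : twos u.+2 <= twos x by apply: leq_count_iota; lia.
have twos_ltm : twos v.+2 <= m by rewrite -total; apply: leq_count_iota.
have twos_xv : twos x <= twos v.+1 by apply: leq_count_iota; lia.
move: twos_gt0 twos_ltm; rewrite !(twosS _.+1) cu cv.
by have := legal (ltn_trans xv (ltnW vn)); rewrite /star_legal cx /=; lia.
Qed.

Lemma star_legal_iso_star : 0 < m ->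
  exists r, wg_iso (forest_graph n (star_parent n)) (add_isolated (star_graph m) r).
Proof.
move=> m_gt0; rewrite star_graphE; set par := star_parent n.
set nodes := [seq v <- iota 0 n | has_parent par v].
have count_par : num_edges par n = m.
  by rewrite num_edges_star // (minn_idPr (leqnSn n)).
have node_par j : j < m -> [/\ nth 0 nodes j < n, has_parent par (nth 0 nodes j)
    & count (has_parent par) (iota 0 (nth 0 nodes j)) = j].
  by move=> jm; apply: nth_filter_iotaP; rewrite -/(num_edges _ _) count_par.
have [_ par0 count0] := node_par 0 m_gt0.
apply: (@forest_iso_tree _ _ _ _ (@star_tree_rooted m) (root (nth 0 nodes 0))) => //.
  by rewrite size_filter -/(num_edges _ _).
move=> i j jm [<-] /=; have [_ parj countj] := node_par j jm.
have : par (nth 0 nodes j) = Some (root (nth 0 nodes j)).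
  by move: parj; rewrite star_has_parent /par /star_parent => ->.
move=> ->; case: (posnP j) => [-> //|j_gt0]; congr Some; apply: star_legal_same_root => //.
rewrite ltnNge; apply/negP => /(leq_count_iota (has_parent par)).
by rewrite countj count0; lia.
Qed.

End Letters.

End StarCode.

Section CommonAbove.
Variables (g : nat -> nat) (n : nat).
Hypothesis g_inj : injective g.
Let c := lehmer g.

Definition avoids213 :=
  forall x y w, x < y -> y < w -> w < n -> g x < g w -> g y < g w -> g x < g y.

(* For [u < v], the number of common out-neighbours of the positions mirroring
   [u] and [v] in the reverse-complement of [g]. *)
Definition common_above u v := count (fun x => [&& v < x, g u < g x & g v < g x]) (iota 0 n).

Lemma root_min p x : x < p -> x != root c p -> g (root c p) < g x.
Proof.
elim/ltn_ind: x => x IH xp neq_xr; have r0 := root_lehmer0 (lehmer_le g) p.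
case: (ltnP x (root c p)) => [|rx]; first exact: ltn_of_lehmer0.
have /lehmer_gt0P[y yx gy] : 0 < c x by apply: (@root_last c p); lia.
case: (eqVneq y (root c p)) => [<- //|neq_yr]; apply: ltn_trans gy.
by apply: IH => //; exact: ltn_trans xp.
Qed.

Lemma below_lehmer1 p x : c p = 1 -> x < p -> (g x < g p) = (x == root c p).
Proof.
move=> c1 xp; have root_below : root c p < p /\ g (root c p) < g p.
  have /lehmer_gt0P[y yp gy] : 0 < c p by rewrite c1.
  split; first by apply: (root_lt (lehmer_le g)); lia.
  case: (eqVneq y (root c p)) => [<- //|neq_yr].
  exact: ltn_trans (root_min yp neq_yr) gy.
have [rp gr] := root_below; case: eqVneq => [-> //|neq_xr].
apply/negbTE/negP => gx; suff : size [:: x; root c p] <= c p by rewrite c1.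
by apply: leq_lehmer => /=; rewrite ?inE ?neq_xr // xp gx rp gr.
Qed.

Lemma below_lehmer2 p x : c p.+1 = 2 -> c p = 1 -> x <= p ->
  (g x < g p.+1) = (x == root c p) || (x == p).
Proof.
move=> c2 c1 xp; have p_gt0 : 0 < p by have := lehmer_le g p; rewrite -/(c p); lia.
have rp : root c p < p by exact: (root_lt (lehmer_le g)).
have gp : g p < g p.+1.
  by rewrite ltnNge; apply/negP => /lehmerS_leq; rewrite -/(c p.+1) -/(c p) c1 c2.
have gr : g (root c p) < g p by rewrite below_lehmer1.
case: eqVneq => [-> /=|neq_xr]; first exact: ltn_trans gp.
case: eqVneq => [-> //|neq_xp] /=; apply/negbTE/negP => gx.
suff : size [:: x; root c p; p] <= c p.+1 by rewrite c2.
apply: leq_lehmer => /=; first by rewrite !inE; lia.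
by lia.
Qed.

Lemma star_forest_two_below u v w : star_forest_code c n -> u < v -> v < w -> w < n ->
  g u < g w -> g v < g w -> [/\ w = v.+1, c w = 2, c v = 1 & u = root c v].
Proof.
move=> star uv vw wn gu gv; have [c_le2 prev1] := star w wn.
have c2 : c w = 2.
  suff : size [:: u; v] <= c w by rewrite /=; lia.
  by apply: leq_lehmer => /=; rewrite ?inE; lia.
case: w vw wn gu gv c_le2 c2 prev1 => // w vw wn gu gv _ c2 /(_ c2) /= c1.
have w_gt0 : 0 < w by have := lehmer_le g w; rewrite -/(c w); lia.
have rw := root_lt (lehmer_le g) w_gt0.
move: gu gv; rewrite !below_lehmer2 //; last by lia.
by move=> eu ev; have -> : v = w; [lia | split=> //; lia].
Qed.

Lemma star_forest_avoids213 : star_forest_code c n -> avoids213.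
Proof.
move=> star u v w uv vw wn gu gv; have [_ _ c1 eu] := star_forest_two_below star uv vw wn gu gv.
by rewrite below_lehmer1 // eu.
Qed.

Lemma star_forest_common_above u v : star_forest_code c n -> u < v -> v < n ->
  common_above u v = (star_parent c n v == Some u).
Proof.
move=> star uv vn; pose edge := (c v.+1 == 2) && (u == root c v).
have -> : common_above u v = count (fun x => (x == v.+1) && edge) (iota 0 n).
  apply: eq_in_count => x; rewrite mem_iota => /andP[_ xn]; rewrite /edge.
  apply/and3P/and3P => [[vx gu gv]|[/eqP ex /eqP c2 /eqP eu]].
    by have [-> c2 _ ->] := star_forest_two_below star uv vx xn gu gv; rewrite c2.
  subst x; have [_ /(_ c2) /= c1] := star _ xn.
  by rewrite !below_lehmer2 ?(ltnW uv) // eu !eqxx orbT.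
rewrite /star_parent; case edgeE : edge; move: edgeE; rewrite /edge.
  move=> /andP[-> /eqP ->]; rewrite andbT.
  under eq_count => x do rewrite andbT.
  by rewrite count_uniq_mem ?iota_uniq // mem_iota; case: ltnP => //; rewrite eqxx.
under eq_count => x do rewrite andbF.
rewrite count_pred0; case: ifP => // /andP[_ ->] /=.
by rewrite (inj_eq (@Some_inj _)) eq_sym => ->.
Qed.

Hypothesis avoid : avoids213.
Hypothesis weight_le1 : forall u v, u < v -> v < n -> common_above u v <= 1.

Lemma common_above_lt2 u v x y : u < v -> v < x -> x < y -> y < n ->
  g u < g x -> g v < g x -> g u < g y -> g v < g y -> False.
Proof.
move=> uv vx xy yn gux gvx guy gvy; have := weight_le1 uv (ltn_trans vx (ltn_trans xy yn)).
rewrite leqNgt => /negP; apply; apply: (@uniq_leq_count _ _ _ [:: x; y]) => /=.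
  by rewrite inE; lia.
by rewrite !mem_iota; lia.
Qed.

Lemma unit_lehmer_leq2 p : p < n -> c p <= 2.
Proof.
move=> pn; rewrite leqNgt; apply/negP => c3.
have [b0 g0] := nth_below (ltnW (ltnW c3)); have [b1 g1] := nth_below (ltnW c3).
have [b2 g2] := nth_below c3.
have b01 := ltn_nth_below (ltn0Sn 0) (ltnW c3); have b12 := ltn_nth_below (ltnSn 1) c3.
by apply: (common_above_lt2 b01 b12 b2 pn) => //; apply: (avoid _ b2 pn) => //; lia.
Qed.

Lemma unit_star_forest : star_forest_code c n.
Proof.
move=> p pn; split=> [|c2]; first exact: unit_lehmer_leq2.
case: p pn c2 => [|p] pn c2 /=; first by have := lehmer_le g 0; rewrite -/(c 0); lia.
have c_gt1 : 1 < lehmer g p.+1 by rewrite -/(c p.+1) c2.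
have [xp gx] := nth_below (ltnW c_gt1); have [yp gy] := nth_below c_gt1.
move: xp gx yp gy (ltn_nth_below (ltn0Sn 0) c_gt1).
move: (nth 0 _ 0) (nth 0 _ 1) => x y xp gx yp gy xy.
case: (ltnP (g p) (g p.+1)) => [gp|gp].
  have := lehmer_ltn (ltnSn p) gp; rewrite -/(c p) -/(c p.+1) c2.
  suff : 0 < c p by lia.
  by apply/lehmer_gt0P; exists x; [lia | apply: (avoid _ (ltnSn p)) => //; lia].
have yp' : y < p by rewrite ltn_neqAle -ltnS yp andbT; apply: contraTneq gy => ->; lia.
by exfalso; apply: (common_above_lt2 xy yp' (ltnSn p) pn) => //; lia.
Qed.

End CommonAbove.

Definition revcomp n (s : 'S_n) : 'S_n :=
  (perm (@rev_ord_inj n) * s * perm (@rev_ord_inj n))%g.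

Lemma revcompE n (s : 'S_n) i : revcomp s (rev_ord i) = rev_ord (s i).
Proof. by rewrite !permM !permE rev_ordK. Qed.

Lemma revcomp_inj n : injective (@revcomp n).
Proof. by move=> s t /mulIg/mulgI. Qed.

Lemma rev_ord_ltn n (i j : 'I_n) : (rev_ord i < rev_ord j) = (j < i).
Proof. by rewrite /=; have := ltn_ord i; have := ltn_ord j; lia. Qed.

Lemma revcomp_ltn n (s : 'S_n) (i j : 'I_n) :
  (perm_fun (revcomp s) i < perm_fun (revcomp s) j) = (s (rev_ord j) < s (rev_ord i)).
Proof. by rewrite !perm_funE -{1}[i]rev_ordK -{1}[j]rev_ordK !revcompE rev_ord_ltn. Qed.

Lemma card_common_out_revcomp n (s : 'S_n) (u v : 'I_n) : u < v ->
  #|common_out s (rev_ord u) (rev_ord v)| = common_above (perm_fun (revcomp s)) n u v.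
Proof.
move=> uv; rewrite /common_above -card_ord_count -(card_imset _ rev_ord_inj).
congr #|pred_of_set _|; apply/setP => x.
rewrite -[x]rev_ordK (mem_imset _ _ rev_ord_inj) !inE !revcomp_ltn /darc !rev_ord_ltn rev_ordK.
by lia.
Qed.

(** * Pattern avoidance *)

Section Patterns.
Variables (n : nat) (s : 'S_n).
Local Notation ord3 i := (@Ordinal 3 i isT).

Lemma contains3P (t : 'S_3) :
  contains s t <-> exists x y w : 'I_n, [/\ x < y, y < w,
    (s x < s y) = (t (ord3 0) < t (ord3 1)),
    (s x < s w) = (t (ord3 0) < t (ord3 2))
  & (s y < s w) = (t (ord3 1) < t (ord3 2))].
Proof.
split=> [[f [f_mono f_iso]]|[x [y [w [xy yw e01 e02 e12]]]]].
  by exists (f (ord3 0)), (f (ord3 1)), (f (ord3 2)); rewrite !f_iso !f_mono.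
pose f (i : 'I_3) := nth x [:: x; y; w] i.
have f_mono (a b : 'I_3) : a < b -> f a < f b.
  by case: a b => [[|[|[|//]]] ?] [[|[|[|//]]] ?] //= _; exact: ltn_trans yw.
exists f; split=> // a b.
have perm_ltn_asym k (u : 'S_k) (i j : 'I_k) : i < j -> (u j < u i) = ~~ (u i < u j).
  move=> ij; rewrite -leqNgt ltn_neqAle; case: eqVneq => // /val_inj/perm_inj ji.
  by rewrite ji ltnn in ij.
have iso_ltn (i j : 'I_3) : i < j -> (s (f i) < s (f j)) = (t i < t j).
  case: i j => [[|[|[|//]]] i3] [[|[|[|//]]] j3] //= _;
    by rewrite (bool_irrelevance i3 isT) (bool_irrelevance j3 isT).
case: (ltngtP a b) => [|ba|/val_inj ->]; [exact: iso_ltn | | by rewrite !ltnn].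
by rewrite (perm_ltn_asym _ s _ _ (f_mono _ _ ba)) (perm_ltn_asym _ t _ _ ba) iso_ltn.
Qed.

Lemma avoids_pat123P : avoids s pat123 <-> avoids123 (perm_fun s) n.
Proof.
rewrite /avoids contains3P !perm1 /=; split=> [no_pat x y w xy yw wn|avoid [x [y [w []]]]].
  have yn := ltn_trans yw wn; have xn := ltn_trans xy yn.
  rewrite (perm_funE s (Ordinal xn)) (perm_funE s (Ordinal yn)) (perm_funE s (Ordinal wn)).
  move=> gxy; rewrite leqNgt; apply/negP => gyw; apply: no_pat.
  exists (Ordinal xn), (Ordinal yn), (Ordinal wn); rewrite gxy gyw.
  by split=> //; exact: ltn_trans gyw.
move=> xy yw gxy _ gyw; have := avoid x y w xy yw (ltn_ord w).
by rewrite !perm_funE => /(_ gxy); rewrite leqNgt gyw.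
Qed.

Lemma pat132E (a : 'I_3) : pat132 a = nth 0 [:: 0; 2; 1] a :> nat.
Proof.
rewrite permE /= -!val_eqE /= !inordK //.
by case: a => [[|[|[|//]]] ?] /=; rewrite ?inordK.
Qed.

Lemma avoids_pat132P : avoids s pat132 <-> avoids213 (perm_fun (revcomp s)) n.
Proof.
rewrite /avoids contains3P !pat132E /=; split=> [no_pat x y w xy yw wn|avoid [x [y [w []]]]].
  have yn := ltn_trans yw wn; have xn := ltn_trans xy yn.
  have := revcomp_ltn s (Ordinal xn) (Ordinal yn).
  have := revcomp_ltn s (Ordinal xn) (Ordinal wn).
  have := revcomp_ltn s (Ordinal yn) (Ordinal wn) => /= -> -> -> sxw syw.
  apply/negPn/negP => /negbTE sxy; apply: no_pat.
  exists (rev_ord (Ordinal wn)), (rev_ord (Ordinal yn)), (rev_ord (Ordinal xn)).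
  by rewrite !rev_ord_ltn sxw syw sxy.
move=> xy yw sxy sxw syw; have := avoid (rev_ord w) (rev_ord y) (rev_ord x).
by rewrite !revcomp_ltn !rev_ordK !rev_ord_ltn xy yw sxy sxw syw 
  => /(_ isT isT (ltn_ord _) isT isT).
Qed.

End Patterns.

(** * The two families in terms of codes *)

Section PathFamily.
Variables (m n : nat) (s : 'S_n).
Hypothesis m_gt0 : 0 < m.
Let g := perm_fun s.
Let c := lehmer g.
Let g_inj : injective g := @perm_fun_inj n s.
Let c_le : forall p, c p <= p := lehmer_le g.

Lemma path_linear_forest r : avoids123 g n ->
  wg_iso (competition_graph s) (add_isolated (path_graph m) r) -> linear_forest_code c n.
Proof.
rewrite path_graphE => avoid iso; apply: unit_triangle_free_linear => //.
  move=> u v uv vn; rewrite -(@card_common_out _ s (Ordinal (ltn_trans uv vn)) (Ordinal vn)) //.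
  apply: unit_weighted_common_out; first exact: iso_unit_weighted iso _.
  by rewrite neq_ltn uv.
move=> u v w uv vw wn.
have vn := ltn_trans vw wn; have un := ltn_trans uv vn; have uw := ltn_trans uv vw.
rewrite -(@card_common_out _ s (Ordinal un) (Ordinal vn)) //.
rewrite -(@card_common_out _ s (Ordinal vn) (Ordinal wn)) //.
rewrite -(@card_common_out _ s (Ordinal un) (Ordinal wn)) // !card_gt0 => edge_uv edge_vw.
apply/eqP; rewrite cards_eq0.
have no_triangle : triangle_free (competition_graph s).
  exact: iso_triangle_free iso (@forest_triangle_free _ _).
have := no_triangle (Ordinal un) (Ordinal vn) (Ordinal wn).
by rewrite /= /comp_adj edge_uv edge_vw !neq_ltn /= uv vw uw => /(_ isT isT)/negbFE.
Qed.

Lemma competition_linear_forest : avoids123 g n -> linear_forest_code c n ->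
  wg_iso (competition_graph s) (forest_graph n (contact_parent c)).
Proof.
move=> avoid linear; apply: (competition_forest (phi := id)); first by exists id.
by move=> u v uv; rewrite card_common_out // (linear_common_below (n := n)).
Qed.

Lemma Winv_path : (s \in Winv n (path_graph m) pat123) = path_accepts m (code s).
Proof.
rewrite inE /code; apply/asboolP/accepts_mkseqP => [[/avoids_pat123P avoid [r iso]]|].
  have linear := path_linear_forest avoid iso.
  have forest_iso := wg_iso_trans (wg_iso_sym (competition_linear_forest avoid linear)) iso.
  rewrite path_graphE in forest_iso.
  have total := iso_tree_num_edges (@path_tree_rooted m) forest_iso.
  rewrite num_edges_contact // in total.
  rewrite path_trace total eqxx; split=> // p pn; rewrite path_trace.
  apply: (linear_forest_path_legal c_le linear total) pn.
  exact: iso_tree_one_component (@path_tree_rooted m) _ forest_iso.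
rewrite path_trace => -[legal /eqP total].
have {}legal p : p < n -> path_legal m (contacts c p, trailing_zeros c p) (c p).
  by move=> /legal; rewrite path_trace.
have linear := path_legal_linear c_le legal.
have avoid : avoids123 g n by apply: small_lehmer_avoids123 => // p /linear[].
split; first exact/avoids_pat123P.
have [r forest_iso] := path_legal_iso_path c_le legal total m_gt0; exists r.
exact: wg_iso_trans (competition_linear_forest avoid linear) forest_iso.
Qed.

End PathFamily.

Section StarFamily.
Variables (m n : nat) (s : 'S_n).
Hypothesis m_gt0 : 0 < m.
Let g := perm_fun (revcomp s).
Let c := lehmer g.
Let g_inj : injective g := @perm_fun_inj n (revcomp s).
Let c_le : forall p, c p <= p := lehmer_le g.

Lemma star_star_forest r : avoids213 g n ->
  wg_iso (competition_graph s) (add_isolated (star_graph m) r) -> star_forest_code c n.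
Proof.
rewrite star_graphE => avoid iso; apply: unit_star_forest => // u v uv vn.
rewrite -(@card_common_out_revcomp _ s (Ordinal (ltn_trans uv vn)) (Ordinal vn)) //.
apply: unit_weighted_common_out; first exact: iso_unit_weighted iso _.
by rewrite (inj_eq rev_ord_inj) neq_ltn uv.
Qed.

Lemma competition_star_forest : star_forest_code c n ->
  wg_iso (competition_graph s) (forest_graph n (star_parent c n)).
Proof.
move=> star; apply: (competition_forest (phi := @rev_ord n)).
  by exists (@rev_ord n); exact: rev_ordK.
by move=> u v uv; rewrite card_common_out_revcomp // star_forest_common_above.
Qed.

Lemma Winv_star : (s \in Winv n (star_graph m) pat132) = star_accepts m (code (revcomp s)).
Proof.
rewrite inE /code; apply/asboolP/accepts_mkseqP => [[/avoids_pat132P avoid [r iso]]|].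
  have star := star_star_forest avoid iso.
  have forest_iso := wg_iso_trans (wg_iso_sym (competition_star_forest star)) iso.
  rewrite star_graphE in forest_iso.
  have total := iso_tree_num_edges (@star_tree_rooted m) forest_iso.
  rewrite num_edges_star // (minn_idPr (leqnSn n)) in total.
  rewrite star_trace // total eqxx; split=> // p pn; rewrite star_trace //.
  apply: (star_forest_star_legal c_le star total) pn.
  exact: iso_tree_one_component (@star_tree_rooted m) _ forest_iso.
rewrite star_trace // => -[legal /eqP total].
have {}legal p : p < n -> star_legal m (twos c p, c p.-1) (c p).
  by move=> /legal; rewrite star_trace.
have star := star_legal_star_forest c_le legal; split.
  by apply/avoids_pat132P; exact: star_forest_avoids213.
have [r forest_iso] := star_legal_iso_star c_le legal total m_gt0; exists r.
exact: wg_iso_trans (competition_star_forest star) forest_iso.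
Qed.

End StarFamily.

Theorem mainTheorem15 (m n : nat) (hm : 1 <= m) (hn : 1 <= n) :
  #|Winv n (path_graph m) pat123| = #|Winv n (star_graph m) pat132|.
Proof.
transitivity #|[set s : 'S_n | path_accepts m (code s)]|.
  by apply: eq_card => s; rewrite Winv_path // inE.
transitivity #|[set s : 'S_n | star_accepts m (code s)]|.
  by rewrite !card_code; exact: count_path_star.
rewrite -(card_preimset _ (@revcomp_inj n)).
by apply: eq_card => s; rewrite Winv_star // !inE.
Qed.
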